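(* Let $p$ be an odd prime. There exists a homogeneous system of linear equations over $\mathbb{F}_p$ of rank at least two which is common but not translation-invariant. (Explicitly, the system $x_1-x_2+x_3-x_4=0$, $x_5-x_6+x_7-x_8+x_9=0$ in nine variables has this property.)
   Context: A system $\Psi$ is a full-rank homogeneous system of $m$ linear equations in $t>m$ variables with coefficients in $\mathbb{F}_p$, given by an $m\times t$ matrix $M_\Psi$; its rank is $m$. For $f:\mathbb{F}_p^n\to\mathbb{C}$ define $T_\Psi(f)=\mathbb{E}_{\mathbf{x}\in(\mathbb{F}_p^n)^t:\,M_\Psi\mathbf{x}=0} f(x_1)\cdots f(x_t)$, where $\mathbb{E}$ denotes the uniform average. $\Psi$ is common if for all $n\ge1$ and all $f:\mathbb{F}_p^n\to[0,1]$, $T_\Psi(f)+T_\Psi(1-f)\ge 2^{1-t}$. $\Psi$ is translation-invariant if $x_1=x_2=\cdots=x_t$ (any common value) is a solution, i.e. the coefficients in each equation sum to zero. *)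

(* Defs.v *)
From HB Require Import structures.
From mathcomp Require Import all_boot all_order all_algebra.
From mathcomp Require Import reals.
Set Implicit Arguments.
Unset Strict Implicit.
Unset Printing Implicit Defensive.
Import Order.TTheory GRing.Theory Num.Theory.
Local Open Scope ring_scope.

Section LinearSystems.
Variables (p m t : nat) (M : 'M['F_p]_(m, t)).

Definition is_system : Prop := (m < t)%N /\ \rank M = m.

(* A tuple in (F_p^n)^t is a t x n matrix x whose i-th row is x_i. *)
Definition solutions (n : nat) : {set 'M['F_p]_(t, n)} :=
  [set x | M *m x == 0].

(* K = R[i] gives the functional on complex-valued functions, and K = R its
   restriction to real-valued ones. *)
Definition Tavg (K : numFieldType) (n : nat) (f : 'rV['F_p]_n -> K) : K :=
  (\sum_(x in solutions n) \prod_(i < t) f (row i x)) / #|solutions n|%:R.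

Definition common (R : realType) : Prop :=
  forall (n : nat) (f : 'rV['F_p]_n -> R),
    (1 <= n)%N ->
    (forall x, 0 <= f x <= 1) ->
    2 ^ (1 - t%:Z) <= Tavg f + Tavg (fun x => 1 - f x).

Definition translation_invariant : Prop :=
  forall (n : nat) (v : 'rV['F_p]_n), (\matrix_(i < t) v) \in solutions n.

End LinearSystems.

Definition nine_variable_system (p : nat) : 'M['F_p]_(2, 9) :=
  \matrix_(i < 2, j < 9)
    (nth [::] [:: [:: 1; -1; 1; -1; 0;  0; 0;  0; 0];
                  [:: 0;  0; 0;  0; 1; -1; 1; -1; 1]] i)`_j.

(* Main.v *)
(** The two equations share no variable, so the count factors as [T f = A f * B f].
    Write [a = E f], [h = f - a], and let [r] be the autocorrelation of [h]; it is unchanged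
    when [f] is replaced by [1 - f] and has mean zero.  With [S = E r^2] and
    [D = E_(u, v) r u * r v * f (- (u + v))] one finds [A f = a^4 + S], [B f = a^5 + D],
    while [1 - f] gives [(1 - a)^4 + S] and [(1 - a)^5 - D].  AM-GM on [r u * r v] yields
    [|D| <= S * min a (1 - a)], which makes the contribution of [S] and [D] nonnegative. *)
Require Import Defs.
From mathcomp Require Import all_boot all_order all_algebra.
From mathcomp Require Import reals ring lra.
Import Order.TTheory GRing.Theory Num.Theory.
Local Open Scope ring_scope.

(** * Uniform averages over a finite abelian group *)

Section Averages.
Variables (R : realFieldType) (V : finZmodType).
Implicit Types (f F G : V -> R) (a c : R).

Let N : R := #|V|%:R.

Definition avg F : R := (\sum_x F x) / N.

Lemma card_zmod_neq0 : N != 0.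
Proof. by rewrite pnatr_eq0 -lt0n; apply/card_gt0P; exists 0. Qed.

Lemma eq_avg {F} G : F =1 G -> avg F = avg G.
Proof. by move=> FG; rewrite /avg (eq_bigr _ (fun x _ => FG x)). Qed.

Lemma avgD F G : avg (fun x => F x + G x) = avg F + avg G.
Proof. by rewrite /avg big_split mulrDl. Qed.

Lemma avgZ c F : avg (fun x => c * F x) = c * avg F.
Proof. by rewrite /avg -mulr_sumr mulrA. Qed.

Lemma avgZr c F : avg (fun x => F x * c) = avg F * c.
Proof. by rewrite mulrC -avgZ; apply: eq_avg => x; rewrite mulrC. Qed.

Lemma avg_cst c : avg (fun=> c) = c.
Proof. by rewrite /avg sumr_const -mulr_natr mulfK ?card_zmod_neq0. Qed.

Lemma avg_bij (s : V -> V) F : bijective s -> avg (fun x => F (s x)) = avg F.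
Proof.
by case=> s' sK s'K; rewrite /avg [in RHS](reindex s) //; exists s' => x _.
Qed.

Lemma avg_addl (d : V) F : avg (fun x => F (d + x)) = avg F.
Proof.
have d_bij : bijective (+%R d) by exists (+%R (- d)); [exact: addKr | exact: addNKr].
exact: avg_bij F d_bij.
Qed.

Lemma avg_addr (d : V) F : avg (fun x => F (x + d)) = avg F.
Proof. by rewrite -[RHS](avg_addl d); apply: eq_avg => x; rewrite addrC. Qed.

Lemma avg_opp F : avg (fun x => F (- x)) = avg F.
Proof. exact: avg_bij F (Bijective opprK opprK).
Qed.

Lemma ler_avg F G : (forall x, F x <= G x) -> avg F <= avg G.
Proof. by move=> FG; rewrite ler_wpM2r ?invr_ge0 ?ler0n ?ler_sum. Qed.

Lemma avg_exchange (F : V -> V -> R) :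
  avg (fun x => avg (F x)) = avg (fun y => avg (F^~ y)).
Proof. by rewrite /avg -!mulr_suml exchange_big. Qed.

(** * Autocorrelation and the two densities built from it *)

Definition autocorr f (d : V) : R := avg (fun y => f (y + d) * f y).

(** The density of additive quadruples weighted by [f], that is, the fourth power of its Gowers U^2
    norm. *)
Definition energy f : R := avg (fun d => autocorr f d ^+ 2).

(** For [F = autocorr f] this is the density of the five-variable equation, with [u] and [v] the
    differences of its first two pairs. Keeping [F] separate lets it be shifted by a constant while
    the weight [f] stays fixed. *)
Definition corr_form f F : R :=
  avg (fun u => avg (fun v => F u * F v * f (- (u + v)))).

Lemma avg_sum_opp f (u : V) : avg (fun v => f (- (u + v))) = avg f.
Proof. by rewrite (avg_addl u (fun v => f (- v))) avg_opp. Qed.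

Lemma autocorr_add_cst f c d :
  autocorr (fun x => c + f x) d = c ^+ 2 + 2 * c * avg f + autocorr f d.
Proof.
rewrite /autocorr (eq_avg (fun y => (c ^+ 2 + c * f (y + d)) + (c * f y + f (y + d) * f y)));
  last by move=> y; ring.
rewrite !avgD avg_cst !avgZ avg_addr; ring.
Qed.

Lemma autocorr_opp f : autocorr (fun x => - f x) =1 autocorr f.
Proof. by move=> d; apply: eq_avg => y; rewrite mulrNN. Qed.

Lemma avg_autocorr f : avg (autocorr f) = avg f ^+ 2.
Proof.
rewrite /autocorr avg_exchange -[RHS]avgZ; apply: eq_avg => y.
by rewrite avgZr (avg_addl y).
Qed.

Section MeanZero.
Variables (r : V -> R) (r0 : avg r = 0).

Lemma energy_add_cst c :
  avg (fun d => (c + r d) ^+ 2) = c ^+ 2 + avg (fun d => r d ^+ 2).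
Proof.
rewrite (eq_avg (fun d => (c ^+ 2 + 2 * c * r d) + r d ^+ 2)); last by move=> d; ring.
by rewrite !avgD avg_cst avgZ r0; ring.
Qed.

(** The terms linear in [r] vanish: averaging over the variable absent from [r] replaces the weight
    by [avg f], and then [r] averages to zero. *)
Lemma corr_form_add_cst f c :
  corr_form f (fun d => c + r d) = c ^+ 2 * avg f + corr_form f r.
Proof.
have fr : avg (fun u => avg (fun v => r u * f (- (u + v)))) = 0.
  rewrite (eq_avg (fun u => r u * avg f)) ?avgZr ?r0 ?mul0r // => u.
  by rewrite avgZ avg_sum_opp.
have fr' : avg (fun u => avg (fun v => r v * f (- (u + v)))) = 0.
  rewrite avg_exchange -[RHS]fr; apply: eq_avg => u; apply: eq_avg => v.
  by rewrite addrC.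
rewrite /corr_form (eq_avg (fun u =>
  (c ^+ 2 * avg f + c * avg (fun v => r u * f (- (u + v)))) +
  (c * avg (fun v => r v * f (- (u + v)))
   + avg (fun v => r u * r v * f (- (u + v)))))); last first.
  move=> u; rewrite -(avg_sum_opp f u) -!avgZ -!avgD; apply: eq_avg => v; ring.
by rewrite !avgD avg_cst !avgZ fr fr'; ring.
Qed.

Lemma corr_form_compl f : corr_form (fun x => 1 - f x) r = - corr_form f r.
Proof.
rewrite /corr_form (eq_avg (fun u => r u * avg r
  + -1 * avg (fun v => r u * r v * f (- (u + v))))); last first.
  by move=> u; rewrite -!avgZ -avgD; apply: eq_avg => v; ring.
by rewrite avgD avgZ avgZr r0 mul0r add0r mulN1r.
Qed.

End MeanZero.

(** After AM-GM each term contains the square of [F] at one variable only; averaging over the other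
    variable sends the weight to [avg f]. *)
Lemma norm_corr_form_le f F : (forall x, 0 <= f x) ->
  `|corr_form f F| <= avg f * avg (fun d => F d ^+ 2).
Proof.
move=> f0; set S := avg (fun d => _ ^+ 2).
have Sl : avg (fun u => avg (fun v => F u ^+ 2 * f (- (u + v)))) = avg f * S.
  rewrite mulrC -avgZr; by apply: eq_avg => u; rewrite avgZ avg_sum_opp.
have Sr : avg (fun u => avg (fun v => F v ^+ 2 * f (- (u + v)))) = avg f * S.
  rewrite avg_exchange -Sl; apply: eq_avg => u; apply: eq_avg => v.
  by rewrite addrC.
(* Here [c] is a sign: [-1] and [1] give the lower and the upper bound. *)
have half c : (forall u v, c * (F u * F v) <= 2^-1 * F u ^+ 2 + 2^-1 * F v ^+ 2) ->
    c * corr_form f F <= avg f * S.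
  move=> amgm.
  have -> : avg f * S = 2^-1 * (avg f * S) + 2^-1 * (avg f * S) by field.
  rewrite -{1}Sl -Sr /corr_form -!avgZ -avgD; apply: ler_avg => u.
  rewrite -!avgZ -avgD; apply: ler_avg => v.
  by have := ler_wpM2r (f0 (- (u + v))) (amgm u v); rewrite mulrDl !mulrA.
rewrite ler_norml; apply/andP; split.
  rewrite lerNl -mulN1r; apply: half => u v.
  have := sqr_ge0 (F u + F v); lra.
rewrite -[corr_form _ _]mul1r; apply: half => u v.
have := sqr_ge0 (F u - F v); lra.
Qed.

(** * Scalar inequalities and the bound for [f] and [1 - f] *)

Lemma pow9_compl_ge a : 2^-1 ^+ 8 <= a ^+ 9 + (1 - a) ^+ 9.
Proof.
pose s := (a - 2^-1) ^+ 2; have s0 : 0 <= s by exact: sqr_ge0.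
(* Expanding around 1/2 cancels the odd powers of [a - 2^-1] and leaves a polynomial in [s] with
   positive coefficients. *)
have -> : a ^+ 9 + (1 - a) ^+ 9 = 2^-1 ^+ 8
   + (9 / 16 * s + 63 / 8 * s ^+ 2 + 21 * s ^+ 3 + 9 * s ^+ 4).
  by rewrite /s; field.
have := exprn_ge0 2 s0; have := exprn_ge0 3 s0; have := exprn_ge0 4 s0.
rewrite lerDl; lra.
Qed.

Lemma energy_form_scalar_ge a S D : 0 <= a <= 1 -> `|D| <= a * S -> `|D| <= (1 - a) * S ->
  2^-1 ^+ 8 <= (a ^+ 4 + S) * (a ^+ 5 + D) + ((1 - a) ^+ 4 + S) * ((1 - a) ^+ 5 - D).
Proof.
move=> a01 Da Db; have := pow9_compl_ge a; case/andP: a01 => a0 a1.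
have b0 : 0 <= 1 - a by lra.
have ab : a + (1 - a) = 1 by ring.
move: (1 - a) ab b0 Db => b ab b0 Db h9.
(* Adding the two bounds on [D] gives [2 * |D| <= S]. *)
have S0 : 0 <= S.
  have := normr_ge0 D; have := lerD Da Db; rewrite -mulrDl ab; lra.
(* The products [S * D] cancel, so this is exactly the excess over [a ^+ 9 + b ^+ 9]. *)
suff : 0 <= S * (a ^+ 5 + b ^+ 5) + D * (a ^+ 4 - b ^+ 4).
  move=> h; apply: le_trans h9 _; rewrite -subr_ge0; apply: le_trans h _.
  by rewrite le_eqVlt; apply/orP; left; apply/eqP; ring.
(* With [x] the smaller density, the worst case is [E = - (x * S)]. The case [a <= b] uses
   [E = - D], the other one [E = D]. *)
have bound (x y E : R) : 0 <= x -> 0 <= y -> x <= y -> `|E| <= x * S ->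
    0 <= S * (y ^+ 5 + x ^+ 5) + E * (y ^+ 4 - x ^+ 4).
  move=> x0 y0 xy Ex.
  have d0 : 0 <= y ^+ 4 - x ^+ 4 by rewrite subr_ge0 lerXn2r.
  have Ege : - (x * S) <= E by have := ler_norml E (x * S); rewrite Ex => /esym/andP[].
  have := ler_wpM2r d0 Ege => h.
  have h2 : 0 <= S * y ^+ 4 * (y - x) by rewrite !mulr_ge0 ?exprn_ge0 ?subr_ge0.
  have h3 : 0 <= S * x ^+ 5 by rewrite mulr_ge0 ?exprn_ge0.
  apply: le_trans (lerD (lexx (S * (y ^+ 5 + x ^+ 5))) h).
  have -> : S * (y ^+ 5 + x ^+ 5) + - (x * S) * (y ^+ 4 - x ^+ 4)
     = S * y ^+ 4 * (y - x) + S * x ^+ 5 + S * x ^+ 5 by ring.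
  by rewrite !addr_ge0.
have [le_ab|/ltW le_ba] := leP a b; last exact: bound.
have := bound a b (- D) a0 b0 le_ab; rewrite normrN => /(_ Da).
by congr (_ <= _); ring.
Qed.

Lemma energy_form_ge f (g := fun x => 1 - f x) : (forall x, 0 <= f x <= 1) ->
  2^-1 ^+ 8 <= energy f * corr_form f (autocorr f) + energy g * corr_form g (autocorr g).
Proof.
move=> f01; pose a := avg f.
have f0 x : 0 <= f x by case/andP: (f01 x).
have g0 x : 0 <= g x by case/andP: (f01 x) => _; rewrite subr_ge0.
have avg_g : avg g = 1 - a.
  by rewrite (eq_avg (fun x => 1 + -1 * f x)) ?avgD ?avg_cst ?avgZ ?mulN1r // => x;
     rewrite mulN1r.
(* Since [f = a + h] and [g = (1 - a) - h], both autocorrelations are a constant plus the same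
   [r]. *)
pose h x := - a + f x; pose r := autocorr h.
have h0 : avg h = 0 by rewrite avgD avg_cst addNr.
have r0 : avg r = 0 by rewrite avg_autocorr h0 expr0n.
have hN0 : avg (fun x => - h x) = 0.
  by rewrite (eq_avg (fun x => -1 * h x)) ?avgZ ?h0 ?mulr0 // => x; rewrite mulN1r.
have rf : autocorr f =1 (fun d => a ^+ 2 + r d).
  move=> d; have := autocorr_add_cst h a d; rewrite h0 mulr0 addr0 => <-.
  by apply: eq_avg => y; rewrite /h; ring.
have rg : autocorr g =1 (fun d => (1 - a) ^+ 2 + r d).
  move=> d; have := autocorr_add_cst (fun x => - h x) (1 - a) d.
  rewrite hN0 mulr0 addr0 autocorr_opp => <-.
  by apply: eq_avg => y; rewrite /g /h; ring.
have a01 : 0 <= a <= 1.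
  have := ler_avg _ _ f0; have := ler_avg _ _ g0.
  by rewrite !avg_cst avg_g subr_ge0 => -> ->.
have congr_form F F' G : F =1 F' -> corr_form G F = corr_form G F'.
  by move=> FF; apply: eq_avg => u; apply: eq_avg => v; rewrite !FF.
rewrite /energy.
rewrite (eq_avg (fun d => (a ^+ 2 + r d) ^+ 2)); last by move=> d; rewrite rf.
rewrite (eq_avg (F := fun d => autocorr g d ^+ 2)
  (fun d => ((1 - a) ^+ 2 + r d) ^+ 2)); last by move=> d; rewrite rg.
rewrite (congr_form _ _ f rf) (congr_form _ _ g rg).
rewrite !energy_add_cst ?corr_form_add_cst // avg_g -/a (corr_form_compl _ r0).
rewrite -!exprM -!exprSr; apply: energy_form_scalar_ge => //.
  exact: norm_corr_form_le.
(* Up to sign the form is also the one weighted by [g], whose mean is [1 - a]. *)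
by rewrite -avg_g -normrN -corr_form_compl //; exact: norm_corr_form_le.
Qed.

End Averages.

Arguments avg {R V}.
Arguments autocorr {R V}.
Arguments energy {R V}.
Arguments corr_form {R V}.

(** * Linear algebra of the nine-variable system *)

Section NineVariables.
Variable p : nat.
Local Notation M := (nine_variable_system p).

Lemma nine_variable_mulmx n (x : 'I_9 -> 'rV['F_p]_n) (c := fun i => x (inord i)) :
  (M *m \matrix_(i < 9) x i == 0) =
  (c 0%N - c 1%N + c 2%N - c 3%N == 0) && (c 4%N - c 5%N + c 6%N - c 7%N + c 8%N == 0).
Proof.
have e (i : 'I_9) : x i = c i by rewrite /c inord_val.
have rows i : row i (M *m \matrix_(i < 9) x i) =
  if i == 0 then c 0%N - c 1%N + c 2%N - c 3%N else c 4%N - c 5%N + c 6%N - c 7%N + c 8%N.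
  rewrite row_mul mulmx_sum_row !big_ord_recr big_ord0 /= !rowK !mxE !e /=.
  by case: i => [[|[|//]] ?] /=;
    rewrite !(scale0r, scale1r, scaleN1r, add0r, addr0).
apply/eqP/andP => [Mx | [/eqP c0 /eqP c1]].
  by have := rows 0; have := rows 1; rewrite Mx !row0 /= => <- <-.
by apply/row_matrixP => i; rewrite rows c0 c1 row0; case: ifP.
Qed.

Lemma rank_nine_variable_system : \rank M = 2.
Proof.
apply/eqP; change (row_free M); apply/row_freeP.
(* Columns 0 and 4 of [M] form the identity, so the matrix selecting them is a right inverse. *)
exists (\matrix_(i < 9, j < 2) ((val i, val j) \in [:: (0, 0); (4, 1)])%N%:R).
apply/matrixP => i j; rewrite !mxE !big_ord_recr big_ord0 /= !mxE /=.
by case: i => [[|[|//]] ?]; case: j => [[|[|//]] ?] /=; rewrite ?(mulr0, mulr1, addr0, add0r).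
Qed.

(** The coefficients of the second equation sum to 1, so the constant solution 1 would force
    [1 = 0]. *)
Lemma nine_variable_not_translation_invariant : ~ translation_invariant M.
Proof.
move=> /(_ 1 (const_mx 1)); rewrite inE nine_variable_mulmx => /andP[_].
rewrite !(addrNK, addNr, subrr, add0r, addrK) => /eqP/rowP/(_ 0).
by rewrite !mxE => /eqP; rewrite oner_eq0.
Qed.

(** * Parametrization of the solution set *)

Variable n : nat.
Local Notation V := 'rV['F_p]_n.

(** The free parameters are the differences [d], [u], [v] and a base point for each pair, so that
    the rows pair up into autocorrelations. The nesting separates the two equations. *)
Definition param_solution (q : V * (V * V) * (V * V * (V * V))) : 'M['F_p]_(9, n) :=
  let: ((d, (y, z)), ((u, v), (a, b))) := q in
  \matrix_(i < 9) [:: y + d; y; z; z + d; a + u; a; b + v; b; - (u + v)]`_i.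

Definition solution_param (x : 'M['F_p]_(9, n)) : V * (V * V) * (V * V * (V * V)) :=
  let c i := row (inord i) x in
  ((c 0%N - c 1%N, (c 1%N, c 2%N)), ((c 4%N - c 5%N, c 6%N - c 7%N), (c 5%N, c 7%N))).

Lemma param_solutionK : cancel param_solution solution_param.
Proof.
case=> [[d [y z]] [[u v] [a b]]]; rewrite /solution_param /param_solution !rowK !inordK //=.
by rewrite ![_ + d]addrC ![_ + u]addrC ![_ + v]addrC !addrK.
Qed.

Lemma param_solution_mem q : param_solution q \in solutions M n.
Proof.
case: q => [[d [y z]] [[u v] [a b]]]; rewrite inE nine_variable_mulmx !inordK //=.
by apply/andP; split; apply/eqP/rowP => k; rewrite !mxE; ring.
Qed.

Lemma solution_paramK : {in solutions M n, cancel solution_param param_solution}.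
Proof.
move=> x; rewrite inE.
have xE : x = \matrix_(i < 9) row i x by apply/row_matrixP => i; rewrite rowK.
rewrite {1}xE nine_variable_mulmx; set c := fun i => row (inord i) x.
case/andP=> /eqP e0 /eqP e1.
rewrite /param_solution /solution_param; apply/row_matrixP => -[i i9].
have -> : Ordinal i9 = inord i by apply: val_inj; rewrite /= inordK.
rewrite rowK. rewrite inordK //.
do 9?[case: i i9 => [|i] i9 //=]; apply/rowP => k;
  move/rowP/(_ k): e0; move/rowP/(_ k): e1; rewrite /c !mxE => e1 e0; try ring.
(* Only rows 3 and 8, counted from zero, remain: they are recovered from the first and the second
   equation respectively. *)
- rewrite [RHS](_ : _ = x (inord 2%N) k + (x (inord 0) k - x (inord 1) k)); [ring|].
  apply/eqP; rewrite -subr_eq0 -oppr_eq0 -[X in _ == X]e0; apply/eqP; ring.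
- apply/eqP; rewrite -subr_eq0 -oppr_eq0 -[X in _ == X]e1; apply/eqP; ring.
Qed.

Lemma sum_solutions (K : nmodType) (F : 'M['F_p]_(9, n) -> K) :
  \sum_(x in solutions M n) F x = \sum_q F (param_solution q).
Proof.
rewrite (reindex_onto param_solution solution_param); last exact: solution_paramK.
by apply: eq_bigl => q; rewrite param_solution_mem param_solutionK eqxx.
Qed.

Lemma card_solutions : #|solutions M n| = (#|{: V}| ^ 7)%N.
Proof.
by rewrite -sum1_card sum_solutions sum1_card !card_prod; ring.
Qed.

(** * Solution densities as averages *)

Section Density.
Variable R : realFieldType.
Implicit Type f : V -> R.

Let N : R := #|{: V}|%:R.

Lemma sum_avg (F : V -> R) : \sum_x F x = N * avg F.
Proof. by rewrite mulrC divfK // card_zmod_neq0. Qed.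

Lemma sum_energy f :
  \sum_(q : V * (V * V)) (f (q.2.1 + q.1) * f q.2.1) * (f (q.2.2 + q.1) * f q.2.2)
  = N ^+ 3 * energy f.
Proof.
rewrite -(pair_bigA _ (fun d w =>
  (f (w.1 + d) * f w.1) * (f (w.2 + d) * f w.2))) /=.
rewrite (exprSr _ 2) -mulrA -sum_avg mulr_sumr; apply: eq_bigr => d _.
rewrite -(pair_bigA _ (fun y z => (f (y + d) * f y) * (f (z + d) * f z))) /=.
by rewrite -exprMn -sum_avg expr2 big_distrlr.
Qed.

(** For fixed differences [u] and [v] the sum over the base points [a] and [b] factors into two
    autocorrelations, each with a factor [N]; the sums over [u] and [v] give the other two. *)
Lemma sum_corr_form f :
  \sum_(q : (V * V) * (V * V))
     (f (q.2.1 + q.1.1) * f q.2.1) * (f (q.2.2 + q.1.2) * f q.2.2)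
     * f (- (q.1.1 + q.1.2))
  = N ^+ 4 * corr_form f (autocorr f).
Proof.
rewrite -(pair_bigA _ (fun e w =>
  (f (w.1 + e.1) * f w.1) * (f (w.2 + e.2) * f w.2) * f (- (e.1 + e.2)))) /=.
rewrite -(pair_bigA _ (fun u v => \sum_(w : V * V)
  (f (w.1 + u) * f w.1) * (f (w.2 + v) * f w.2) * f (- (u + v)))) /=.
rewrite (exprSr _ 3) -mulrA -sum_avg mulr_sumr; apply: eq_bigr => u _.
rewrite (exprSr _ 2) -mulrA -sum_avg mulr_sumr; apply: eq_bigr => v _.
rewrite -mulr_suml mulrA; congr (_ * _).
rewrite -(pair_bigA _ (fun a b => (f (a + u) * f a) * (f (b + v) * f b))) /=.
by rewrite expr2 mulrACA -!sum_avg big_distrlr.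
Qed.

Lemma Tavg_nine_variable_system f :
  Tavg M f = energy f * corr_form f (autocorr f).
Proof.
rewrite /Tavg card_solutions natrX -/N sum_solutions.
(* The two groups of parameters are independent, and [N ^+ 3 * N ^+ 4] matches the number of
   solutions. *)
have -> : \sum_q \prod_(i < 9) f (row i (param_solution q)) =
    (N ^+ 3 * energy f) * (N ^+ 4 * corr_form f (autocorr f)).
  rewrite -sum_energy -sum_corr_form big_distrlr pair_bigA /=.
  apply: eq_bigr => -[[d [y z]] [[u v] [a b]]] _.
  rewrite !big_ord_recr big_ord0 /param_solution !rowK /=; ring.
have N0 : N != 0 by exact: card_zmod_neq0.
by field.
Qed.

End Density.
End NineVariables.

(** * Commonness and the conclusion *)

Lemma nine_variable_system_common (R : realType) (p : nat) :
  common (nine_variable_system p) R.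
Proof.
move=> n f _ f01; rewrite !Tavg_nine_variable_system.
have -> : 2 ^ (1 - 9%:Z) = 2^-1 ^+ 8 :> R by rewrite exprVn.
exact: energy_form_ge.
Qed.

Theorem theorem1p6 (R : realType) (p : nat) (p_prime : prime p) (p_odd : odd p) :
  (exists (m t : nat) (M : 'M['F_p]_(m, t)),
     [/\ is_system M, (2 <= \rank M)%N, common M R
       & ~ translation_invariant M]) /\
  [/\ is_system (nine_variable_system p),
      (2 <= \rank (nine_variable_system p))%N,
      common (nine_variable_system p) R
    & ~ translation_invariant (nine_variable_system p)].
Proof.
have nineP : [/\ is_system (nine_variable_system p),
    (2 <= \rank (nine_variable_system p))%N,
    common (nine_variable_system p) R
  & ~ translation_invariant (nine_variable_system p)].
  split; first by split => //; exact: rank_nine_variable_system.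
  - by rewrite rank_nine_variable_system.
  - exact: nine_variable_system_common.
  - exact: nine_variable_not_translation_invariant.
by split; first exists 2%N, 9%N, (nine_variable_system p).
Qed.
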